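(* Let $U \subset \mathbb{R}^n$ be an open convex set and let $f \colon U \to \mathbb{R}$ be a convex function. Suppose $(x_k)_{k\ge 0}$ is a BFGS sequence for $f$ contained in $U$, and that the level set $\{x \in U : f(x) \le f(x_0)\}$ is bounded. Assume there is an open set $V \subset U$ containing the closure $\mathrm{cl}\,\{x_k : k\ge 0\}$ and satisfying $\inf_{x \in V} f(x) = \min f$, such that for every constant $\delta > 0$ there exist a convex open set $U_\delta \subset U$ containing $\{x \in U : f(x) \le f(x_0)\}$ and a twice continuously differentiable convex function $f_\delta \colon U_\delta \to \mathbb{R}$ with $f_\delta(x) = f(x)$ for all $x \in U_\delta$ satisfying $d_{V^c}(x) > \delta$. Then the sequence of function values $f(x_k)$ converges to $\min f$.
   Context: Here $\min f$ denotes the minimum (infimum) value of $f$ over $U$; $V^c = \mathbb{R}^n \setminus V$, and $d_{V^c}(x) = \inf_{z \in V^c}\|z - x\|$ is the Euclidean distance from $x$ to $V^c$. A sequence $(x_k)$ is a BFGS sequence for $f$ if $f$ is differentiable at each $x_k$ with $\nabla f(x_k) \neq 0$, and there exist parameters $0<\mu<\nu<1$ and a positive definite $n\times n$ matrix $H_0$ such that, with $s_k = x_{k+1}-x_k$, $y_k = \nabla f(x_{k+1}) - \nabla f(x_k)$, $V_k = I - \frac{s_k y_k^T}{s_k^T y_k}$ and $H_{k+1} = V_k H_k V_k^T + \frac{s_k s_k^T}{s_k^T y_k}$, one has for all $k=0,1,2,\dots$: $H_k \nabla f(x_k) \in -\mathbb{R}_+ s_k$, $f(x_{k+1}) \le f(x_k)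 + \mu \nabla f(x_k)^T s_k$, and $\nabla f(x_{k+1})^T s_k \ge \nu \nabla f(x_k)^T s_k$. *)

(* Defs.v *)
From HB Require Import structures.
From mathcomp Require Import all_boot all_order all_algebra.
From mathcomp Require Import all_classical all_reals all_analysis.
Set Implicit Arguments. Unset Strict Implicit. Unset Printing Implicit Defensive.
Import Order.TTheory GRing.Theory Num.Theory.
Import numFieldNormedType.Exports.
Local Open Scope classical_set_scope.
Local Open Scope ring_scope.

Section Defs.
Variables (R : realType) (n : nat).
Notation vec := 'cV[R]_n.

Definition dotv (u v : vec) : R := \sum_(i < n) u i 0 * v i 0.
Definition enorm (u : vec) : R := Num.sqrt (dotv u u).

Definition evec (i : 'I_n) : vec := delta_mx i 0.

Definition grad (f : vec -> R) (x : vec) : vec :=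
  \col_(i < n) ('d f x (evec i)).

(* distance from x to the complement of V, in \bar R (= +oo if V^c is empty) *)
Definition dist_compl (V : set vec) (x : vec) : \bar R :=
  ereal_inf [set (enorm (z - x))%:E | z in ~` V].

Definition inf_on (f : vec -> R) (A : set vec) : \bar R :=
  ereal_inf [set (f x)%:E | x in A].

Definition convex_set_R (A : set vec) : Prop :=
  forall x y (t : R), A x -> A y -> 0 <= t <= 1 -> A (t *: x + (1 - t) *: y).

Definition convex_on (A : set vec) (f : vec -> R) : Prop :=
  forall x y (t : R), A x -> A y -> 0 <= t <= 1 ->
    f (t *: x + (1 - t) *: y) <= t * f x + (1 - t) * f y.

Definition ebounded (A : set vec) : Prop :=
  exists M : R, forall x, A x -> enorm x <= M.

Definition C2_on (A : set vec) (f : vec -> R) : Prop :=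
  {within A, continuous f} /\
  (forall i : 'I_n, forall x, A x -> derivable f x (evec i)) /\
  (forall i : 'I_n, {within A, continuous (fun y => 'D_(evec i) f y)}) /\
  (forall i j : 'I_n, forall x, A x ->
     derivable (fun y => 'D_(evec i) f y) x (evec j)) /\
  (forall i j : 'I_n,
     {within A, continuous (fun z => 'D_(evec j) (fun y => 'D_(evec i) f y) z)}).

Definition pos_def (H : 'M[R]_n) : Prop :=
  H^T = H /\ forall v : vec, v != 0 -> 0 < dotv v (H *m v).

(* BFGS inverse-Hessian update *)
Definition bfgs_update (f : vec -> R) (x : nat -> vec) (k : nat) (H : 'M[R]_n)
  : 'M[R]_n :=
  let s := x k.+1 - x k in
  let y := grad f (x k.+1) - grad f (x k) in
  let Vk := 1%:M - (dotv s y)^-1 *: (s *m y^T) in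
  Vk *m H *m Vk^T + (dotv s y)^-1 *: (s *m s^T).

Fixpoint bfgs_H (f : vec -> R) (x : nat -> vec) (H0 : 'M[R]_n) (k : nat)
  : 'M[R]_n :=
  match k with
  | 0 => H0
  | k'.+1 => bfgs_update f x k' (bfgs_H f x H0 k')
  end.

Definition bfgs_sequence (f : vec -> R) (x : nat -> vec) : Prop :=
  (forall k, differentiable f (x k) /\ grad f (x k) != 0) /\
  exists (mu nu : R) (H0 : 'M[R]_n),
    [/\ 0 < mu, mu < nu, nu < 1, pos_def H0 &
    forall k : nat,
      let s := x k.+1 - x k in
      [/\ exists t : R, 0 <= t /\ bfgs_H f x H0 k *m grad f (x k) = - (t *: s),
          f (x k.+1) <= f (x k) + mu * dotv (grad f (x k)) s &
          dotv (grad f (x k.+1)) s >= nu * dotv (grad f (x k)) s]].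

End Defs.

(* Main.v *)
Require Import Defs.
From HB Require Import structures.
From mathcomp Require Import all_boot all_order all_algebra.
From mathcomp Require Import all_classical all_reals all_analysis.
From mathcomp Require Import perm ring lra.
Import Order.TTheory GRing.Theory Num.Theory.
Import numFieldNormedType.Exports.
Set Implicit Arguments.
Unset Strict Implicit.
Unset Printing Implicit Defensive.
Local Open Scope classical_set_scope.
Local Open Scope ring_scope.

(** The closure [C] of the iterates is compact, lies in the sublevel set of
    [x_0] and keeps a positive distance from the complement of [V], so [f] is
    itself twice continuously differentiable near [C].  By Jensen's inequality
    a bound on the second derivatives along the coordinate axes is enough to
    give [f], at every point of [C], a quadratic upper model of uniform radius
    and curvature; compared with the tangent inequality it shows that the
    gradient is cocoercive on [C], [|y_k|^2 <= L <s_k, y_k>].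

    Powell's argument then applies to [B_k = H_k^-1], where
    [B_k s_k = - lam_k g_k].  The trace of [B_k] grows at most linearly and its
    determinant is multiplied by at least [(1 - nu) / lam_k], while the sum of
    the [- <g_k, s_k>] is finite; by the arithmetic-geometric mean inequality
    this is incompatible with a positive lower bound on [|g_k|].  Finally the
    tangent inequality at the bounded points [x_k] turns [liminf |g_k| = 0]
    into convergence of the values to the infimum. *)

Lemma near_dist_lt (R : numFieldType) (V : normedModType R) (c : V) (e : R) :
  0 < e -> \forall z \near c, `|z - c| < e.
Proof. by apply: cvgr_distC_lt; exact: cvg_id. Qed.

Section MatrixNorm.
Variables (R : realDomainType) (m n : nat).
Implicit Type A : 'M[R]_(m, n).

Lemma mx_norm_ge_coord A i j : `|A i j| <= `|A|.
Proof.
rewrite [leRHS]mx_normrE.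
pose entry (ij : 'I_m * 'I_n) := `|A ij.1 ij.2|.
exact: (le_bigmax_cond _ entry (j := (i, j))).
Qed.

Lemma mx_norm_le A c : 0 <= c -> (forall i j, `|A i j| <= c) -> `|A| <= c.
Proof.
by move=> c0 Ac; rewrite [leLHS]mx_normrE; apply: bigmax_le => // -[i j].
Qed.

End MatrixNorm.

Lemma mx_norm_tr (R : realDomainType) (m n : nat) (A : 'M[R]_(m, n)) :
  `|A^T| = `|A|.
Proof.
apply/eqP; rewrite eq_le; apply/andP; split; apply: mx_norm_le => // i j.
  by rewrite mxE mx_norm_ge_coord.
by rewrite (le_trans _ (mx_norm_ge_coord A^T j i))// mxE.
Qed.

Lemma trmx_continuous (R : realFieldType) (m n : nat) :
  continuous (trmx : 'M[R]_(m, n) -> 'M[R]_(n, m)).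
Proof.
move=> A B /nbhs_ballP[e /= e0 AeB]; apply/nbhs_ballP; exists e => // C.
rewrite -ball_normE/= => AC; apply: AeB.
by rewrite -ball_normE/= -linearB mx_norm_tr.
Qed.

Section DotProduct.
Variables (R : realType) (n : nat).
Implicit Types (u v w : 'cV[R]_n) (A : 'M[R]_n).

Lemma mul_tr_col u v : u^T *m v = (dotv u v)%:M.
Proof.
rewrite [LHS]mx11_scalar; congr (_%:M); rewrite mxE.
by apply: eq_bigr => i _; rewrite mxE.
Qed.

Lemma mul_col_tr u v w : u *m v^T *m w = dotv v w *: u.
Proof. by rewrite -mulmxA mul_tr_col mul_mx_scalar. Qed.

Lemma mxtrace_mul_col_tr u v : \tr (u *m v^T) = dotv v u.
Proof. by rewrite mxtrace_mulC mul_tr_col mxtrace_scalar. Qed.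

Lemma dotvC u v : dotv u v = dotv v u.
Proof. by apply: eq_bigr => i _; rewrite mulrC. Qed.

Lemma dotvDr u v w : dotv u (v + w) = dotv u v + dotv u w.
Proof. by rewrite -big_split /=; apply: eq_bigr => i _; rewrite mxE mulrDr. Qed.

Lemma dotvZr a u v : dotv u (a *: v) = a * dotv u v.
Proof. by rewrite mulr_sumr; apply: eq_bigr => i _; rewrite mxE mulrCA. Qed.

Lemma dotvNr u v : dotv u (- v) = - dotv u v.
Proof. by rewrite -scaleN1r dotvZr mulN1r. Qed.

Lemma dotvBr u v w : dotv u (v - w) = dotv u v - dotv u w.
Proof. by rewrite dotvDr dotvNr. Qed.

Lemma dotv0r u : dotv u 0 = 0.
Proof. by rewrite -[0](scale0r 0) dotvZr mul0r. Qed.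

Lemma dotvDl u v w : dotv (u + v) w = dotv u w + dotv v w.
Proof. by rewrite dotvC dotvDr !(dotvC w). Qed.

Lemma dotvZl a u v : dotv (a *: u) v = a * dotv u v.
Proof. by rewrite dotvC dotvZr dotvC. Qed.

Lemma dotvNl u v : dotv (- u) v = - dotv u v.
Proof. by rewrite dotvC dotvNr dotvC. Qed.

Lemma dotvBl u v w : dotv (u - v) w = dotv u w - dotv v w.
Proof. by rewrite dotvDl dotvNl. Qed.

Lemma dotv_mulmx u A v : dotv u (A *m v) = dotv (A^T *m u) v.
Proof.
rewrite -!mxtrace_mul_col_tr trmx_mul trmxK mulmxA [RHS]mxtrace_mulC.
by rewrite !mulmxA.
Qed.

Lemma dotv_ge0 u : 0 <= dotv u u.
Proof. by apply: sumr_ge0 => i _; rewrite -expr2 sqr_ge0. Qed.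

Lemma dotv_eq0 u : (dotv u u == 0) = (u == 0).
Proof.
apply/eqP/eqP => [uu0|->]; last exact: dotv0r.
apply/colP => i; rewrite mxE; apply/eqP; rewrite -sqrf_eq0 expr2; apply/eqP.
by apply: psumr_eq0P uu0 _ _ => // j _; rewrite -expr2 sqr_ge0.
Qed.

Lemma dotv_gt0 u : (0 < dotv u u) = (u != 0).
Proof. by rewrite lt_def dotv_ge0 andbT dotv_eq0. Qed.

Lemma enorm_ge0 u : 0 <= enorm u.
Proof. exact: sqrtr_ge0. Qed.

Lemma sqr_enorm u : enorm u ^+ 2 = dotv u u.
Proof. by rewrite sqr_sqrtr ?dotv_ge0. Qed.

Lemma enorm_gt0 u : (0 < enorm u) = (u != 0).
Proof. by rewrite sqrtr_gt0 dotv_gt0. Qed.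

Lemma enormN u : enorm (- u) = enorm u.
Proof. by rewrite /enorm dotvNl dotvNr opprK. Qed.

Lemma dotv_le_enorm u v : dotv u v <= enorm u * enorm v.
Proof.
have [->|u0] := eqVneq u 0; first by rewrite dotvC dotv0r mulr_ge0 ?enorm_ge0.
have [->|v0] := eqVneq v 0; first by rewrite dotv0r mulr_ge0 ?enorm_ge0.
have uv_gt0 : 0 < enorm u * enorm v by rewrite mulr_gt0 ?enorm_gt0.
have := dotv_ge0 (enorm v *: u - enorm u *: v).
rewrite dotvBl !dotvBr !dotvZl !dotvZr -!sqr_enorm (dotvC v u) => sq_ge0.
rewrite -(ler_pM2l uv_gt0); lra.
Qed.

Lemma dotv_subr_le_enorm u v w :
  dotv u (v - w) <= enorm u * (enorm v + enorm w).
Proof.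
by rewrite dotvDr mulrDr -(enormN w) lerD ?dotv_le_enorm.
Qed.

Lemma norm_le_enorm u : `|u| <= enorm u.
Proof.
apply: mx_norm_le => [|i j]; first exact: enorm_ge0.
rewrite (ord1 j) -sqrtr_sqr ler_sqrt ?dotv_ge0// /dotv (bigD1 i)//=.
rewrite -expr2 lerDl.
by apply: sumr_ge0 => k _; rewrite -expr2 sqr_ge0.
Qed.

Lemma col_sum_evec u : u = \sum_(i < n) u i 0 *: evec R i.
Proof.
by rewrite [LHS]matrix_sum_delta; apply: eq_bigr => i _; rewrite big_ord1.
Qed.

Lemma norm_scale_evec_le (a : R) (i : 'I_n) : `|a *: evec R i| <= `|a|.
Proof.
apply: mx_norm_le => // j k; rewrite !mxE.
by case: (_ && _); rewrite ?mulr1 // mulr0 normr0.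
Qed.

Lemma dotv_evec A i j : dotv (evec R i) (A *m evec R j) = A i j.
Proof.
rewrite /dotv (bigD1 i)//= big1 ?addr0.
  by rewrite mxE !eqxx mul1r -colE mxE.
by move=> k ki; rewrite mxE (negPf ki) mul0r.
Qed.

End DotProduct.

Lemma det_sub_mulmxC (R : comNzRingType) (m n : nat)
    (A : 'M[R]_(m, n)) (B : 'M[R]_(n, m)) :
  \det (1%:M - A *m B) = \det (1%:M - B *m A).
Proof.
have factor : block_mx 1%:M 0 B 1%:M *m block_mx 1%:M A 0 (1%:M - B *m A) =
    block_mx (1%:M - A *m B) A 0 1%:M *m block_mx 1%:M 0 B 1%:M.
  rewrite !mulmx_block !mulmx0 !mul0mx !mul1mx !mulmx1 !addr0 !add0r.
  by rewrite subrK addrC subrK.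
have := congr1 determinant factor.
by rewrite !det_mulmx !det_ublock !det_lblock !det1 !mul1r !mulr1.
Qed.

Section PositiveDefinite.
Variables (R : realType) (n : nat).
Implicit Types (H B : 'M[R]_n) (v : 'cV[R]_n).

Lemma pos_def_unit H : pos_def H -> H \in unitmx.
Proof.
move=> [Hsym Hpos]; rewrite unitmxE unitfE; apply/negP => /det0P[v v0 vH].
have tv0 : v^T != 0 by rewrite trmx_eq0.
by have := Hpos _ tv0; rewrite -{1}Hsym -trmx_mul vH trmx0 dotv0r ltxx.
Qed.

Lemma pos_def_ge0 H v : pos_def H -> 0 <= dotv v (H *m v).
Proof.
move=> [_ Hpos]; have [->|/Hpos/ltW//] := eqVneq v 0.
by rewrite mulmx0 dotv0r.
Qed.

Lemma pos_def_inv H : pos_def H -> pos_def (invmx H).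
Proof.
move=> Hpd; have Hu := pos_def_unit Hpd; case: (Hpd) => [Hsym Hpos].
have invH_sym : (invmx H)^T = invmx H by rewrite trmx_inv Hsym.
split=> // v v0; rewrite dotv_mulmx invH_sym -{2}[v](mulKVmx Hu).
apply: Hpos; apply: contraNneq v0 => invHv0.
by rewrite -[v](mulKVmx Hu) invHv0 mulmx0.
Qed.

Lemma pos_def_diag_ge0 B i : pos_def B -> 0 <= B i i.
Proof. by move=> Bpd; rewrite -dotv_evec pos_def_ge0. Qed.

Lemma pos_def_trace_ge0 B : pos_def B -> 0 <= \tr B.
Proof. by move=> Bpd; apply: sumr_ge0 => i _; exact: pos_def_diag_ge0. Qed.

Lemma pos_def_norm_le_trace B i j : pos_def B -> `|B i j| <= \tr B.
Proof.
move=> Bpd; have [Bsym _] := Bpd.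
have diag_le k : B k k <= \tr B.
  rewrite /mxtrace (bigD1 k)//= lerDl sumr_ge0// => l _.
  exact: pos_def_diag_ge0.
have form_ge0 c : 0 <= B i i + c * (B i j + B j i) + c ^+ 2 * B j j.
  have := pos_def_ge0 (evec R i + c *: evec R j) Bpd.
  rewrite mulmxDr -scalemxAr dotvDl !dotvDr !dotvZl !dotvZr !dotv_evec; lra.
have Bji : B j i = B i j by rewrite -{1}Bsym mxE.
have := form_ge0 1; have := form_ge0 (- 1); rewrite Bji ler_norml.
by have := diag_le i; have := diag_le j; lra.
Qed.

Lemma pos_def_det_le_trace B : pos_def B -> `|\det B| <= n`!%:R * \tr B ^+ n.
Proof.
move=> Bpd; apply: le_trans (ler_norm_sum _ _ _) _.
rewrite -card_Sn mulr_natl -sumr_const.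
apply: ler_sum => p _; rewrite normrM normrX normrN1 expr1n mul1r normr_prod.
rewrite -[X in \tr B ^+ X](card_ord n) -prodr_const.
by apply: ler_prod => i _; rewrite normr_ge0 pos_def_norm_le_trace.
Qed.

End PositiveDefinite.

Section BfgsStep.
Variables (R : realType) (n : nat).
Implicit Types (A H B : 'M[R]_n) (s y v : 'cV[R]_n).

Definition secant_proj s y : 'M[R]_n := 1%:M - (dotv s y)^-1 *: (s *m y^T).

Definition bfgs_step H s y : 'M[R]_n :=
  secant_proj s y *m H *m (secant_proj s y)^T + (dotv s y)^-1 *: (s *m s^T).

Definition bfgs_hessian_step B s y : 'M[R]_n :=
  B - (dotv s (B *m s))^-1 *: (B *m s *m (B *m s)^T)
    + (dotv s y)^-1 *: (y *m y^T).

Lemma tr_secant_proj s y : (secant_proj s y)^T = secant_proj y s.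
Proof.
by rewrite /secant_proj linearB linearZ/= trmx1 trmx_mul trmxK dotvC.
Qed.

Lemma secant_proj_mul s y v :
  secant_proj s y *m v = v - (dotv y v / dotv s y) *: s.
Proof. by rewrite mulmxBl mul1mx -scalemxAl mul_col_tr scalerA mulrC. Qed.

Lemma secant_proj_self s y : dotv s y != 0 -> secant_proj s y *m s = 0.
Proof. by move=> sy0; rewrite secant_proj_mul dotvC divff// scale1r subrr. Qed.

Lemma tr_mul_secant_proj s y : dotv s y != 0 -> y^T *m secant_proj s y = 0.
Proof.
move=> sy0; rewrite -tr_secant_proj -trmx_mul secant_proj_self ?trmx0//.
by rewrite dotvC.
Qed.

Lemma mul_secant_proj_id A s y : A *m s = 0 -> A *m secant_proj s y = A.
Proof.
move=> As0; rewrite mulmxBr mulmx1 -scalemxAr mulmxA As0.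
by rewrite mul0mx scaler0 subr0.
Qed.

Lemma invmx_form_gt0 H s y :
  pos_def H -> 0 < dotv s y -> 0 < dotv s (invmx H *m s).
Proof.
move=> /pos_def_inv[_ Bpos] sy_gt0; apply: Bpos.
by apply: contraTneq sy_gt0 => ->; rewrite dotvC dotv0r ltxx.
Qed.

Lemma bfgs_step_pos_def H s y :
  pos_def H -> 0 < dotv s y -> pos_def (bfgs_step H s y).
Proof.
move=> Hpd sy_gt0; have [Hsym Hpos] := Hpd; split=> [|v v0].
  by rewrite /bfgs_step linearD/= linearZ/= !trmx_mul !trmxK Hsym mulmxA.
have -> : dotv v (bfgs_step H s y *m v) =
    dotv (secant_proj y s *m v) (H *m (secant_proj y s *m v))
    + (dotv s y)^-1 * dotv s v ^+ 2.
  rewrite mulmxDl dotvDr -scalemxAl mul_col_tr !dotvZr (dotvC v s) -expr2.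
  rewrite tr_secant_proj -!mulmxA (dotv_mulmx v (secant_proj s y)).
  by rewrite tr_secant_proj.
have [sv0|sv0] := eqVneq (dotv s v) 0.
  by rewrite secant_proj_mul sv0 mul0r scale0r subr0 expr0n/= mulr0 addr0 Hpos.
apply: ltr_wpDl; first exact: pos_def_ge0.
by rewrite mulr_gt0 ?invr_gt0// exprn_even_gt0.
Qed.

Lemma bfgs_step_secant H s y :
  dotv s y != 0 -> y^T *m bfgs_step H s y = s^T.
Proof.
move=> sy0; rewrite mulmxDr !mulmxA tr_mul_secant_proj// !mul0mx add0r.
rewrite -scalemxAr mulmxA mul_tr_col mul_scalar_mx (dotvC y) scalerA.
by rewrite mulVf ?scale1r.
Qed.

Lemma bfgs_hessian_stepE B s y :
  B^T = B -> bfgs_hessian_step B s y =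
    B *m secant_proj s (B *m s) + (dotv s y)^-1 *: (y *m y^T).
Proof.
by move=> Bsym; rewrite mulmxBr mulmx1 -scalemxAr mulmxA.
Qed.

Lemma invmx_bfgs_step H s y : pos_def H -> 0 < dotv s y ->
  invmx (bfgs_step H s y) = bfgs_hessian_step (invmx H) s y.
Proof.
move=> Hpd sy_gt0; have sy0 : dotv s y != 0 by rewrite gt_eqF.
have ys0 : dotv y s != 0 by rewrite dotvC.
have Hu := pos_def_unit Hpd; have [Bsym _] := pos_def_inv Hpd.
have sBs_gt0 := invmx_form_gt0 Hpd sy_gt0.
set B := invmx H in Bsym sBs_gt0 *.
pose C := B *m secant_proj s (B *m s).
have C_s : C *m s = 0 by rewrite -mulmxA secant_proj_self ?mulmx0 ?gt_eqF.
have C_H : C *m H = secant_proj (B *m s) s.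
  rewrite /C mulmxBr mulmx1 -scalemxAr mulmxBl mulVmx// -scalemxAl trmx_mul.
  by rewrite Bsym -!mulmxA mulVmx// mulmx1 mulmxA /secant_proj dotvC.
have proj_proj : secant_proj (B *m s) s *m secant_proj y s = secant_proj y s.
  rewrite mulmxBl mul1mx -scalemxAl -mulmxA tr_mul_secant_proj//.
  by rewrite mulmx0 scaler0 subr0.
have C_step : C *m bfgs_step H s y = secant_proj y s.
  rewrite [C *m _]mulmxDr tr_secant_proj !mulmxA (mul_secant_proj_id _ C_s).
  by rewrite C_H proj_proj -scalemxAr mulmxA C_s mul0mx scaler0 addr0.
have inverse : bfgs_hessian_step B s y *m bfgs_step H s y = 1%:M.
  rewrite bfgs_hessian_stepE// -/C mulmxDl C_step -scalemxAl -mulmxA.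
  by rewrite bfgs_step_secant// /secant_proj dotvC subrK.
have step_unit := pos_def_unit (bfgs_step_pos_def Hpd sy_gt0).
by rewrite -[LHS]mul1mx -inverse -mulmxA mulmxV// mulmx1.
Qed.

Lemma mxtrace_bfgs_hessian_step B s y :
  \tr (bfgs_hessian_step B s y) =
    \tr B - dotv (B *m s) (B *m s) / dotv s (B *m s) + dotv y y / dotv s y.
Proof.
by rewrite !mxtraceD raddfN/= !mxtraceZ !mxtrace_mul_col_tr ![_^-1 * _]mulrC.
Qed.

(* With [kappa ^+ 2 = <s, y> / <s, B s>] the cross terms produced by the
   rank-one perturbation [1 - s w^T] reassemble into [s s^T / <s, y>]. *)
Lemma bfgs_step_congruence H s y (kappa : R) (B := invmx H)
    (w := (dotv s y)^-1 *: (y + kappa *: (B *m s))) :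
  pos_def H -> 0 < dotv s y -> kappa ^+ 2 = dotv s y / dotv s (B *m s) ->
  bfgs_step H s y = (1%:M - s *m w^T) *m H *m (1%:M - s *m w^T)^T.
Proof.
move=> Hpd sy_gt0 kappa2; have sy0 : dotv s y != 0 by rewrite gt_eqF.
have Hu := pos_def_unit Hpd; have [Bsym _] := pos_def_inv Hpd.
have sBs0 : dotv s (B *m s) != 0 by rewrite gt_eqF ?(invmx_form_gt0 Hpd sy_gt0).
set tau := dotv s y in sy0 kappa2 w *.
set sigma := dotv s (B *m s) in sBs0 kappa2.
have wT : w^T = tau^-1 *: y^T + (tau^-1 * kappa) *: (B *m s)^T.
  by rewrite /w scalerDr scalerA [LHS]linearD !linearZ.
have WE : 1%:M - s *m w^T =
    secant_proj s y - (tau^-1 * kappa) *: (s *m (B *m s)^T).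
  by rewrite wT mulmxDr -!scalemxAr opprD addrA.
have WH : (1%:M - s *m w^T) *m H =
    secant_proj s y *m H - (tau^-1 * kappa) *: (s *m s^T).
  by rewrite WE mulmxBl -scalemxAl trmx_mul Bsym -!mulmxA mulVmx// mulmx1.
have WT : (1%:M - s *m w^T)^T =
    secant_proj y s - (tau^-1 * kappa) *: (B *m s *m s^T).
  by rewrite WE linearB linearZ/= tr_secant_proj trmx_mul trmxK.
have := secant_proj_self sy0.
have : s^T *m secant_proj y s = 0.
  by rewrite tr_mul_secant_proj// dotvC.
rewrite WH WT /bfgs_step tr_secant_proj -/tau.
move: (secant_proj s y) (secant_proj y s) => P Q sQ Ps.
rewrite mulmxBl !mulmxBr -!scalemxAl -!scalemxAr.
have -> : P *m H *m (B *m s *m s^T) = 0.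
  by rewrite -!mulmxA mulKVmx// mulmxA Ps mul0mx.
have -> : s *m s^T *m Q = 0 by rewrite -mulmxA sQ mulmx0.
have -> : s *m s^T *m (B *m s *m s^T) = sigma *: (s *m s^T).
  by rewrite mulmxA mul_col_tr -scalemxAl.
rewrite !scaler0 subr0 sub0r opprK !scalerA; congr (_ + _ *: _).
have -> : tau^-1 * kappa * (tau^-1 * kappa) * sigma =
    tau^-1 ^+ 2 * kappa ^+ 2 * sigma by ring.
by rewrite kappa2; field; rewrite sBs0 sy0.
Qed.

Lemma det_bfgs_step H s y : pos_def H -> 0 < dotv s y ->
  \det (bfgs_step H s y) = \det H * (dotv s (invmx H *m s) / dotv s y).
Proof.
move=> Hpd sy_gt0; have sy0 : dotv s y != 0 by rewrite gt_eqF.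
have sBs_gt0 := invmx_form_gt0 Hpd sy_gt0.
pose kappa := Num.sqrt (dotv s y / dotv s (invmx H *m s)).
have kappa2 : kappa ^+ 2 = dotv s y / dotv s (invmx H *m s).
  by rewrite sqr_sqrtr// divr_ge0// ltW.
rewrite (bfgs_step_congruence Hpd sy_gt0 kappa2) !det_mulmx det_tr.
rewrite det_sub_mulmxC mul_tr_col -raddfB det_scalar1 dotvZl dotvDl dotvZl.
rewrite (dotvC y) (dotvC _ s) mulrAC mulrC; congr (_ * _).
set tau := dotv s y in sy0 kappa2 *; set sigma := dotv s _ in sBs_gt0 kappa2 *.
pose detW := 1 - tau^-1 * (tau + kappa * sigma); rewrite -/detW.
have -> : detW * detW = kappa ^+ 2 * (sigma / tau) ^+ 2 by rewrite /detW; field.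
by rewrite kappa2; field; rewrite sy0 gt_eqF.
Qed.

End BfgsStep.

Section NumericSequences.
Variable R : realFieldType.
Implicit Types (u d E rho : nat -> R) (c : R) (k : nat).

Lemma sum_le_decrease u d k :
  (forall j, d j <= u j - u j.+1) -> \sum_(j < k) d j <= u 0%N - u k.
Proof.
move=> du; rewrite -[leRHS]opprB -telescope_sumr// -sumrN big_mkord.
by apply: ler_sum => j _; rewrite opprB.
Qed.

Lemma prod_le_ratio u rho k : (forall j, 0 <= rho j) ->
  (forall j, u j * rho j <= u j.+1) -> u 0%N * \prod_(j < k) rho j <= u k.
Proof.
move=> rho0 urho; elim: k => [|k IH]; first by rewrite big_ord0 mulr1.
by rewrite big_ord_recr/= mulrA (le_trans (ler_wpM2r (rho0 k) IH)).
Qed.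

Lemma prod_le_expr_mean E c k : (forall j, 0 <= E j) ->
  \sum_(j < k) E j <= c * k%:R -> \prod_(j < k) E j <= c ^+ k.
Proof.
move=> E0; case: k => [|k] Ec; first by rewrite big_ord0 expr0.
have sumE_ge0 : 0 <= \sum_(j < k.+1) E j by apply: sumr_ge0.
have [AGM _] := @leif_AGM R 'I_k.+1 predT (fun j => E j) (fun j _ => E0 j).
rewrite card_ord in AGM; apply: (le_trans AGM).
have mean_le : (\sum_(j < k.+1) E j) / k.+1%:R <= c by rewrite ler_pdivrMr.
have mean_ge0 : 0 <= (\sum_(j < k.+1) E j) / k.+1%:R by rewrite divr_ge0.
by rewrite lerXn2r// nnegrE (le_trans mean_ge0).
Qed.

End NumericSequences.

Lemma superexponential_decay (R : archiRealFieldType) (n : nat) (q C e : R) :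
  0 <= q -> 0 <= C -> 0 < e ->
  exists2 k, (0 < k)%N & C * k%:R ^+ n * (q / k%:R) ^+ k < e.
Proof.
move=> q0 C0 e0.
have [k k_gt0] : exists2 k, (0 < k)%N & Num.max (q * 2 ^+ n.+1) (C / e) < k%:R.
  by eexists; [|exact: truncnS_gt].
have kR_gt0 : 0 < k%:R :> R by rewrite ltr0n.
rewrite gt_max => /andP[qk Ck]; exists k => //.
have k_le : k%:R <= 2 ^+ k :> R by rewrite -natrX ler_nat ltnW// ltn_expl.
have pow_le : k%:R ^+ n <= (2 ^+ k) ^+ n :> R by rewrite lerXn2r// nnegrE ltW.
have ratio_le : (q / k%:R) ^+ k <= ((2 ^+ k) ^+ n.+1)^-1.
  have base_le : q / k%:R <= (2 ^+ n.+1)^-1.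
    by rewrite ler_pdivrMr// mulrC ler_pdivlMr ?exprn_gt0// ltW.
  by rewrite exprAC -exprVn lerXn2r ?nnegrE ?divr_ge0 ?invr_ge0 ?exprn_ge0.
apply: (@le_lt_trans _ _ (C / 2 ^+ k)); last first.
  rewrite ltr_pdivrMr ?exprn_gt0// mulrC -ltr_pdivrMr//.
  exact: lt_le_trans Ck k_le.
rewrite -mulrA ler_wpM2l//.
apply: (@le_trans _ _ ((2 ^+ k) ^+ n * ((2 ^+ k) ^+ n.+1)^-1)).
  by apply: ler_pM => //; rewrite exprn_ge0// ?divr_ge0// ltW.
by rewrite exprS invfM mulrCA divff ?mulr1// expf_neq0 ?gt_eqF ?exprn_gt0.
Qed.

(* In the application [T] and [D] are the trace and determinant of the Hessian
   approximations, [a] the decreases [- <g, s>], [b] the squared gradient norms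
   and [lam] the factors with [B s = - lam g]. *)
Section Powell.
Variables (R : archiRealFieldType) (n : nat) (T D a b lam : nat -> R).
Variables (M theta C S : R).
Hypotheses (M_ge0 : 0 <= M) (theta_gt0 : 0 < theta) (C_ge0 : 0 <= C).
Hypotheses (T_ge0 : forall k, 0 <= T k) (D_gt0 : forall k, 0 < D k).
Hypotheses (a_gt0 : forall k, 0 < a k) (lam_gt0 : forall k, 0 < lam k).
Hypothesis T_step : forall k, T k.+1 <= T k - lam k * b k / a k + M.
Hypothesis D_step : forall k, D k * (theta / lam k) <= D k.+1.
Hypothesis D_le_T : forall k, D k <= C * T k ^+ n.
Hypothesis sum_a_le : forall k, \sum_(j < k) a j <= S.

Lemma powell_trace_le k : (0 < k)%N ->
  T k + \sum_(j < k) lam j * b j / a j <= (T 0%N + M) * k%:R.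
Proof.
move=> k_gt0.
have decrease j : lam j * b j / a j - M <= T j - T j.+1.
  by move: (T_step j); lra.
have := @sum_le_decrease _ T _ k decrease.
rewrite big_split/= sumr_const card_ord -mulr_natr.
have : T 0%N <= T 0%N * k%:R by rewrite ler_peMr// ler1n.
by lra.
Qed.

Lemma powell_det_le e k : 0 < e -> (forall j, e <= b j) ->
  D 0%N * (theta * e) ^+ k <=
  D k * (\prod_(j < k) (lam j * b j / a j) * \prod_(j < k) a j).
Proof.
move=> e_gt0 b_ge.
have -> : (theta * e) ^+ k =
    (\prod_(j < k) (theta / lam j)) * \prod_(j < k) (lam j * e).
  rewrite -big_split/= -[in LHS](card_ord k) -prodr_const.
  by apply: eq_bigr => j _; field; rewrite gt_eqF.
rewrite mulrA; apply: ler_pM.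
- by rewrite mulr_ge0 ?prodr_ge0// ?ltW// => j _; rewrite divr_ge0// ltW.
- by apply: prodr_ge0 => j _; rewrite mulr_ge0// ltW.
- apply: (@prod_le_ratio _ D (fun j => theta / lam j)) => // j.
  by rewrite divr_ge0// ltW.
rewrite -big_split/=; apply: ler_prod => j _.
by rewrite divfK ?gt_eqF// ler_pM2l// b_ge mulr_ge0// ltW.
Qed.

Lemma powell_liminf e : 0 < e -> exists k, b k < e.
Proof.
move=> e_gt0; apply: contrapT => /forallNP no_small.
have b_ge k : e <= b k by rewrite leNgt; exact/negP/no_small.
pose r j := lam j * b j / a j.
have r_ge0 j : 0 <= r j.
  by rewrite divr_ge0 ?mulr_ge0 ?(le_trans _ (b_ge j))// ltW.
pose c := T 0%N + M; have c_ge0 : 0 <= c by rewrite addr_ge0.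
have S_ge0 : 0 <= S by have := sum_a_le 0; rewrite big_ord0.
have thetae_gt0 : 0 < theta * e by rewrite mulr_gt0.
have q_ge0 : 0 <= c * S / (theta * e) by rewrite divr_ge0 ?mulr_ge0// ltW.
have Ccn_ge0 : 0 <= C * c ^+ n by rewrite mulr_ge0 ?exprn_ge0.
have [k k_gt0] := superexponential_decay n q_ge0 Ccn_ge0 (D_gt0 0%N).
apply/negP; rewrite -leNgt -(ler_pM2r (exprn_gt0 k thetae_gt0)).
have k0 : k%:R != 0 :> R by rewrite pnatr_eq0 -lt0n.
have trace_le := powell_trace_le k_gt0; rewrite -/c in trace_le.
have sum_r_ge0 : 0 <= \sum_(j < k) r j by apply: sumr_ge0.
have Dk_le : D k <= C * (c * k%:R) ^+ n.
  apply: (le_trans (D_le_T k)); rewrite ler_wpM2l// lerXn2r ?nnegrE ?mulr_ge0//.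
  by apply: le_trans trace_le; rewrite lerDl.
have prod_r_le : \prod_(j < k) r j <= c ^+ k.
  by apply: prod_le_expr_mean => //; apply: le_trans trace_le; rewrite lerDr.
have prod_a_le : \prod_(j < k) a j <= (S / k%:R) ^+ k.
  by apply: prod_le_expr_mean => [j|]; [exact: ltW|rewrite divfK].
apply: (le_trans (powell_det_le k e_gt0 b_ge)).
have -> : C * c ^+ n * k%:R ^+ n * (c * S / (theta * e) / k%:R) ^+ k
    * (theta * e) ^+ k = C * (c * k%:R) ^+ n * (c ^+ k * (S / k%:R) ^+ k).
  rewrite -[C * _ * _]mulrA -[LHS]mulrA -!exprMn; congr (_ * _ ^+ k).
  by field; rewrite k0 !gt_eqF.
have prod_r_ge0 : 0 <= \prod_(j < k) r j by apply: prodr_ge0.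
have prod_a_ge0 : 0 <= \prod_(j < k) a j by apply: prodr_ge0 => j _; exact: ltW.
by apply: ler_pM; [exact: ltW|exact: mulr_ge0|exact: Dk_le|exact: ler_pM].
Qed.

End Powell.

Section BfgsIterates.
Variables (R : realType) (n : nat) (f : 'cV[R]_n -> R) (x : nat -> 'cV[R]_n).
Variables (mu nu : R) (H0 : 'M[R]_n).
Hypotheses (mu_gt0 : 0 < mu) (nu_lt1 : nu < 1) (H0_pd : pos_def H0).
Hypothesis grad_neq0 : forall k, grad f (x k) != 0.

Local Notation g k := (grad f (x k)).
Local Notation s k := (x k.+1 - x k).
Local Notation y k := (g k.+1 - g k).
Local Notation H := (bfgs_H f x H0).
Local Notation B k := (invmx (H k)).

Hypothesis direction :
  forall k, exists t : R, 0 <= t /\ H k *m g k = - (t *: s k).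
Hypothesis armijo : forall k, f (x k.+1) <= f (x k) + mu * dotv (g k) (s k).
Hypothesis wolfe : forall k, nu * dotv (g k) (s k) <= dotv (g k.+1) (s k).

Lemma bfgs_HS k : H k.+1 = bfgs_step (H k) (s k) (y k).
Proof. by []. Qed.

Lemma bfgs_inv_direction k : pos_def (H k) ->
  exists lam : R,
    [/\ 0 < lam, B k *m s k = - (lam *: g k) & dotv (g k) (s k) < 0].
Proof.
move=> Hpd; have [t [t_ge0 Hg]] := direction k.
have gHg_gt0 : 0 < dotv (g k) (H k *m g k) by case: Hpd => _; apply.
rewrite Hg dotvNr dotvZr oppr_gt0 in gHg_gt0.
have t_gt0 : 0 < t.
  rewrite lt_def t_ge0 andbT; apply: contraTneq gHg_gt0 => ->.
  by rewrite mul0r ltxx.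
exists t^-1; rewrite invr_gt0.
split=> //; last by rewrite -(pmulr_rlt0 _ t_gt0).
rewrite -[g k](mulKmx (pos_def_unit Hpd)) Hg mulmxN -scalemxAr scalerN opprK.
by rewrite scalerA mulVf ?scale1r// gt_eqF.
Qed.

Lemma bfgs_curvature_ge k :
  (1 - nu) * - dotv (g k) (s k) <= dotv (s k) (y k).
Proof.
rewrite (dotvC (s k)) dotvBl mulrN mulrBl mul1r opprB lerD2r.
exact: wolfe.
Qed.

Lemma bfgs_curvature_gt0 k : dotv (g k) (s k) < 0 -> 0 < dotv (s k) (y k).
Proof.
move=> gs_lt0; apply: lt_le_trans (bfgs_curvature_ge k).
by rewrite mulr_gt0 ?subr_gt0 ?oppr_gt0.
Qed.

Lemma bfgs_H_pos_def k : pos_def (H k).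
Proof.
elim: k => [//|k Hpd]; have [lam [_ _ gs_lt0]] := bfgs_inv_direction Hpd.
by rewrite bfgs_HS; exact/bfgs_step_pos_def/bfgs_curvature_gt0.
Qed.

Lemma bfgs_descent k : dotv (g k) (s k) < 0.
Proof. by have [lam []] := bfgs_inv_direction (bfgs_H_pos_def k). Qed.

Lemma bfgs_values_decrease k : f (x k.+1) <= f (x k).
Proof.
apply: (le_trans (armijo k)); rewrite gerDl pmulr_rle0//.
exact/ltW/bfgs_descent.
Qed.

Lemma bfgs_trace_step L lam k : 0 < lam -> B k *m s k = - (lam *: g k) ->
  dotv (y k) (y k) <= L * dotv (s k) (y k) ->
  \tr (B k.+1) <= \tr (B k) - lam * dotv (g k) (g k) / - dotv (g k) (s k) + L.
Proof.
move=> lam_gt0 Bs yL; have gs_lt0 := bfgs_descent k.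
have sy_gt0 := bfgs_curvature_gt0 gs_lt0.
rewrite bfgs_HS (invmx_bfgs_step (bfgs_H_pos_def k) sy_gt0).
rewrite mxtrace_bfgs_hessian_step Bs.
apply: lerD; last by rewrite ler_pdivrMr.
rewrite dotvNl !dotvNr opprK dotvZl !dotvZr (dotvC (s k)) le_eqVlt.
by apply/orP; left; apply/eqP; field; rewrite lt_eqF//= gt_eqF.
Qed.

Lemma bfgs_det_step lam k : 0 < lam -> B k *m s k = - (lam *: g k) ->
  `|\det (B k)| * ((1 - nu) / lam) <= `|\det (B k.+1)|.
Proof.
move=> lam_gt0 Bs; have gs_lt0 := bfgs_descent k.
have sy_gt0 := bfgs_curvature_gt0 gs_lt0.
rewrite bfgs_HS !det_inv (det_bfgs_step (bfgs_H_pos_def k) sy_gt0) Bs invfM.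
rewrite invf_div dotvNr dotvZr (dotvC _ (g k)) normrM ler_wpM2l// -mulrN.
have lamgs_gt0 : 0 < lam * - dotv (g k) (s k) by rewrite mulr_gt0 ?oppr_gt0.
rewrite ger0_norm ?divr_ge0 ?(ltW sy_gt0) ?(ltW lamgs_gt0)// ler_pdivlMr//.
by rewrite mulrA divfK ?gt_eqF// bfgs_curvature_ge.
Qed.

Lemma bfgs_decrease_sum_le m k : (forall j, m <= f (x j)) ->
  \sum_(j < k) - dotv (g j) (s j) <= (f (x 0%N) - m) / mu.
Proof.
move=> f_ge; rewrite ler_pdivlMr// mulrC mulr_sumr.
apply: (@le_trans _ _ (f (x 0%N) - f (x k))); last by rewrite lerB.
apply: (@sum_le_decrease _ (fun j => f (x j))
  (fun j => mu * - dotv (g j) (s j))) => j.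
by move: (armijo j); rewrite mulrN; lra.
Qed.

Lemma bfgs_liminf_grad L m :
  (forall k, dotv (y k) (y k) <= L * dotv (s k) (y k)) ->
  (forall k, m <= f (x k)) ->
  forall e, 0 < e -> exists k, dotv (g k) (g k) < e.
Proof.
move=> secant_le f_ge.
have [lam lamP] := choice (fun k => bfgs_inv_direction (bfgs_H_pos_def k)).
have L_ge0 : 0 <= L.
  have := le_trans (dotv_ge0 _) (secant_le 0%N).
  by rewrite pmulr_lge0// bfgs_curvature_gt0// bfgs_descent.
have nu1 : 0 < 1 - nu by rewrite subr_gt0.
have Bpd k : pos_def (B k) by apply: pos_def_inv; exact: bfgs_H_pos_def.
apply: (@powell_liminf R n (fun k => \tr (B k)) (fun k => `|\det (B k)|)
  (fun k => - dotv (g k) (s k)) (fun k => dotv (g k) (g k)) lam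
  L (1 - nu) n`!%:R ((f (x 0%N) - m) / mu)) => // k.
- exact: pos_def_trace_ge0.
- by rewrite normr_gt0 -unitfE -unitmxE pos_def_unit.
- by rewrite oppr_gt0 bfgs_descent.
- by have [] := lamP k.
- by have [lam_gt0 Bs _] := lamP k; exact: bfgs_trace_step.
- by have [lam_gt0 Bs _] := lamP k; exact: bfgs_det_step.
- exact: pos_def_det_le_trace.
- exact: bfgs_decrease_sum_le.
Qed.

End BfgsIterates.

Section BfgsSequence.
Variables (R : realType) (n : nat) (f : 'cV[R]_n -> R) (x : nat -> 'cV[R]_n).
Hypothesis x_bfgs : bfgs_sequence f x.

Lemma bfgs_sequence_nonincreasing :
  {homo (fun k => f (x k)) : i j / (i <= j)%N >-> j <= i}.
Proof.
have [xP [mu [nu [H0 [mu0 _ nu1 H0_pd iterP]]]]] := x_bfgs.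
apply/nonincreasing_seqP => k.
apply: (@bfgs_values_decrease R n f x mu nu H0) => // j; first exact: (xP j).2.
all: by case: (iterP j).
Qed.

Lemma bfgs_sequence_liminf_grad (L m : R) :
  (forall k, let y := grad f (x k.+1) - grad f (x k) in
    dotv y y <= L * dotv (x k.+1 - x k) y) ->
  (forall k, m <= f (x k)) ->
  forall e, 0 < e -> exists k, enorm (grad f (x k)) < e.
Proof.
have [xP [mu [nu [H0 [mu0 _ nu1 H0_pd iterP]]]]] := x_bfgs.
move=> secant_le f_ge e e_gt0.
have [k gk_lt] : exists k, dotv (grad f (x k)) (grad f (x k)) < e ^+ 2.
  apply: (@bfgs_liminf_grad R n f x mu nu H0 _ _ _ _ _ _ _ L m) => //
    [j|j|j|j|].
  - exact: (xP j).2.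
  - by case: (iterP j).
  - by case: (iterP j).
  - by case: (iterP j).
  - by rewrite exprn_gt0.
by exists k; rewrite -(@ltr_pXn2r _ 2) ?nnegrE ?enorm_ge0 ?ltW// sqr_enorm.
Qed.

End BfgsSequence.

Section ConvexFunctions.
Variables (R : realType) (n : nat).
Implicit Types (U : set 'cV[R]_n) (f : 'cV[R]_n -> R).
Implicit Types (c d g q u v z : 'cV[R]_n).

Lemma diff_dotv_grad f u v : differentiable f u -> 'd f u v = dotv (grad f u) v.
Proof.
move=> fu; rewrite {1}[v]col_sum_evec linear_sum; apply: eq_bigr => i _.
by rewrite linearZ mxE/= mulrC.
Qed.

Definition subgradient U f u g : Prop :=
  forall z, U z -> f u + dotv g (z - u) <= f z.

Lemma convex_subgradient_grad U f u : convex_on U f -> U u ->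
  differentiable f u -> subgradient U f u (grad f u).
Proof.
move=> fcvx Uu fu z Uz; rewrite addrC -lerBrDr -diff_dotv_grad// -deriveE//.
have /cvg_dnbhs_at_right slope : h^-1 *: ((f \o shift u) (h *: (z - u)) - f u)
    @[h --> 0^'] --> 'D_(z - u) f u by exact: diff_derivable.
apply: (cvgr_to_le slope); near=> h.
have h0 : 0 < h by near: h; exact: nbhs_right_gt.
have h1 : h <= 1 by near: h; exact: nbhs_right_le.
rewrite /= [_ *: _]mulrC ler_pdivrMr//.
have -> : h *: (z - u) + u = h *: z + (1 - h) *: u.
  by rewrite scalerBr scalerBl scale1r -addrA [- _ + u]addrC.
have h01 : 0 <= h <= 1 by rewrite h1 ltW.
by move: (fcvx z u h Uz Uu h01); lra.
Unshelve. all: by end_near. Qed.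

Lemma subgradient_le_enorm U f u g z : subgradient U f u g -> U z ->
  f u <= f z + enorm g * (enorm u + enorm z).
Proof.
move=> gP /gP; have := dotv_subr_le_enorm g u z.
by rewrite -[z - u]opprB dotvNr; lra.
Qed.

(* The weights need not sum to [1]: the point [q] carries the missing mass. *)
Lemma convex_jensen U f (I : Type) (r : seq I) (w : I -> R)
    (p : I -> 'cV[R]_n) q
    (W := \sum_(i <- r) w i) (b := \sum_(i <- r) w i *: p i + (1 - W) *: q) :
  convex_set_R U -> convex_on U f -> (forall i, 0 <= w i) -> W <= 1 ->
  (forall i, U (p i)) -> U q ->
  U b /\ f b <= \sum_(i <- r) w i * f (p i) + (1 - W) * f q.
Proof.
move=> Ucvx fcvx w_ge0; rewrite /b /W => + Up {b W}.
elim: r q => [|i r IH] q; rewrite ?big_nil ?big_cons.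
  by rewrite subr0 !add0r scale1r mul1r.
set W := \sum_(_ <- _) _ in IH * => W_le1 Uq.
have wi_le : w i <= 1 - W by lra.
have mass_ge0 : 0 <= 1 - W by rewrite (le_trans (w_ge0 i)).
pose t := w i / (1 - W).
have tW : t * (1 - W) = w i.
  have [W1|W1] := eqVneq (1 - W) 0; last by rewrite divfK.
  by rewrite W1 mulr0; apply/le_anti; rewrite w_ge0 -W1 wi_le.
have t01 : 0 <= t <= 1.
  rewrite /t divr_ge0 ?w_ge0//=; have [->|W1] := eqVneq (1 - W) 0.
    by rewrite invr0 mulr0 ler01.
  by rewrite ler_pdivrMr ?mul1r// lt_def W1.
pose q' := t *: p i + (1 - t) *: q.
have Uq' : U q' by exact: Ucvx.
have fq' : (1 - W) * f q' <= w i * f (p i) + (1 - (w i + W)) * f q.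
  have := ler_wpM2l mass_ge0 (fcvx _ _ _ (Up i) Uq t01).
  by rewrite -tW; lra.
have W'_le1 : W <= 1 by rewrite -subr_ge0.
have [Ub fb] := IH q' W'_le1 Uq'.
have -> : w i *: p i + \sum_(j <- r) w j *: p j + (1 - (w i + W)) *: q =
    \sum_(j <- r) w j *: p j + (1 - W) *: q'.
  rewrite scalerDr !scalerA [_ * t]mulrC tW mulrBr mulr1 [_ * t]mulrC tW.
  rewrite addrA [w i *: _ + _]addrC opprD [- w i - W]addrC.
  by rewrite [1 + (_ + _)]addrA.
by split=> //; apply: (le_trans fb); lra.
Qed.

Lemma convex_axis_le U f u d : convex_set_R U -> convex_on U f -> U u ->
  (forall i, U (u + (n.+1%:R * d i 0) *: evec R i)) ->
  U (u + d) /\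
  f (u + d) <= f u
    + n.+1%:R^-1 * \sum_(i < n) (f (u + (n.+1%:R * d i 0) *: evec R i) - f u).
Proof.
move=> Ucvx fcvx Uu Up; have N0 : n.+1%:R != 0 :> R by rewrite pnatr_eq0.
have sumN : \sum_(i < n) n.+1%:R^-1 = n%:R / n.+1%:R :> R.
  by rewrite sumr_const card_ord mulrC mulr_natr.
have mass_le1 : \sum_(i < n) n.+1%:R^-1 <= 1 :> R.
  by rewrite sumN ler_pdivrMr ?ltr0n// mul1r ler_nat.
have N_ge0 (i : 'I_n) : 0 <= n.+1%:R^-1 :> R by rewrite invr_ge0.
have [] := convex_jensen Ucvx fcvx N_ge0 mass_le1 Up Uu.
have -> : \sum_(i < n) n.+1%:R^-1 *: (u + (n.+1%:R * d i 0) *: evec R i)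
    + (1 - \sum_(i < n) n.+1%:R^-1) *: u = u + d.
  under eq_bigr do rewrite scalerDr scalerA mulKf//.
  by rewrite big_split/= -scaler_suml addrAC -scalerDl [_ + (1 - _)]addrC subrK
    scale1r -col_sum_evec.
move=> Uud fud; split=> //; apply: (le_trans fud).
rewrite sumrB mulrBr -!mulr_sumr sumN sumr_const card_ord -mulr_natr le_eqVlt.
by apply/orP; left; apply/eqP; field.
Qed.

Lemma convex_le_max U f u v (t : R) : convex_on U f ->
  U (u + v) -> U (u - v) -> `|t| <= 1 ->
  f (u + t *: v) <= Num.max (f (u + v)) (f (u - v)).
Proof.
move=> fcvx Uuv Uvu; rewrite ler_norml => /andP[t_ge t_le].
have w01 : 0 <= (1 + t) / 2 <= 1 by lra.
have -> : u + t *: v = (1 + t) / 2 *: (u + v) + (1 - (1 + t) / 2) *: (u - v).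
  rewrite !scalerDr !scalerN addrACA -scalerDl -scalerBl.
  by congr (_ + _ *: _); [rewrite addrC subrK scale1r|field].
apply: (le_trans (fcvx _ _ _ Uuv Uvu w01)).
set M := Num.max _ _; have [w0 w1] := andP w01.
have fuv : (1 + t) / 2 * f (u + v) <= (1 + t) / 2 * M.
  by rewrite ler_wpM2l// le_max lexx.
have fvu : (1 - (1 + t) / 2) * f (u - v) <= (1 - (1 + t) / 2) * M.
  by rewrite ler_wpM2l ?subr_ge0// le_max lexx orbT.
by lra.
Qed.

Lemma convex_near_bounded U f c : open U -> convex_set_R U -> convex_on U f ->
  U c -> exists K, \forall z \near c, f z <= K.
Proof.
move=> oU Ucvx fcvx Uc.
have /nbhs_normP[r /= r_gt0 rU] : nbhs c U by apply: open_nbhs_nbhs.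
pose v (i : 'I_n) := (r / 2) *: evec R i.
have U_axis i (t : R) : `|t| <= 1 -> U (c + t *: v i).
  move=> t1; apply: rU; rewrite /= opprD addNKr normrN scalerA.
  rewrite (le_lt_trans (norm_scale_evec_le _ _))// normrM.
  rewrite (@le_lt_trans _ _ `|r / 2|) ?ler_piMl// gtr0_norm ?divr_gt0//.
  by rewrite gtr_pMr// invf_lt1// ltr1n.
pose h i := Num.max (f (c + v i)) (f (c - v i)).
exists (f c + n.+1%:R^-1 * \sum_(i < n) (h i - f c)).
have N_gt0 : 0 < n.+1%:R :> R by rewrite ltr0n.
have near_c : \forall z \near c, `|z - c| < r / 2 / n.+1%:R.
  by apply: near_dist_lt; rewrite !divr_gt0.
near=> z; pose t i := n.+1%:R * (z - c) i 0 / (r / 2).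
have t1 i : `|t i| <= 1.
  rewrite normrM [`|_^-1|]ger0_norm ?invr_ge0 ?divr_ge0 ?(ltW r_gt0)//.
  rewrite ler_pdivrMr ?divr_gt0// mul1r normrM ger0_norm// mulrC -ler_pdivlMr//.
  apply: le_trans (mx_norm_ge_coord _ _ _) (ltW _); near: z; exact: near_c.
have tv i : (n.+1%:R * (z - c) i 0) *: evec R i = t i *: v i.
  by rewrite scalerA divfK ?gt_eqF ?divr_gt0.
have [i|_] := @convex_axis_le U f c (z - c) Ucvx fcvx Uc.
  by rewrite tv; exact: U_axis.
rewrite [c + (z - c)]addrC subrK => /le_trans; apply.
rewrite lerD2l ler_wpM2l ?invr_ge0//.
apply: ler_sum => i _; rewrite lerD2r tv.
apply: (convex_le_max fcvx) => //.
  by rewrite -[v i]scale1r; apply: U_axis; rewrite normr1.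
by rewrite -scaleN1r; apply: U_axis; rewrite normrN1.
Unshelve. all: by end_near. Qed.

Lemma convex_sublevel_closure U f (a : R) c : open U -> convex_set_R U ->
  convex_on U f -> U c -> closure [set z | U z /\ f z <= a] c -> f c <= a.
Proof.
move=> oU Ucvx fcvx Uc cl.
have [K] := convex_near_bounded oU Ucvx fcvx Uc.
move=> fK; have /nbhs_normP[r /= r_gt0 rP] : \forall z \near c, U z /\ f z <= K.
  by near=> z; split; near: z => //; exact: open_nbhs_nbhs.
have f_le (t : R) : 0 < t -> t <= 1 -> f c <= a + t * (K - a).
  move=> t_gt0 t_le1.
  have near_c : \forall z \near c, `|z - c| < t * r.
    by apply: near_dist_lt; rewrite mulr_gt0.
  have [z [[Uz fz] /= zc]] := cl _ near_c.
  pose w := z + t^-1 *: (c - z).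
  have [/=|Uw fw] := rP w.
    have -> : c - w = (t^-1 - 1) *: (z - c).
      by rewrite /w -[c - z]opprB scalerN scalerBl scale1r !opprB addrCA.
    rewrite normrZ ger0_norm ?subr_ge0 ?invf_ge1//.
    rewrite (@le_lt_trans _ _ (t^-1 * `|z - c|)) ?ler_wpM2r ?gerBl//.
    by rewrite mulrC ltr_pdivrMr// mulrC.
  have -> : c = t *: w + (1 - t) *: z.
    rewrite /w scalerDr scalerA divff ?gt_eqF// scale1r scalerBl scale1r.
    by rewrite -addrA [c - z + _]addrA subrK [RHS]addrC subrK.
  have t01 : 0 <= t <= 1 by rewrite t_le1 ltW.
  apply: (le_trans (fcvx _ _ _ Uw Uz t01)).
  have := ler_wpM2l (ltW t_gt0) fw.
  have mass_ge0 : 0 <= 1 - t by rewrite subr_ge0.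
  by have := ler_wpM2l mass_ge0 fz; lra.
have : a + t * (K - a) @[t --> (0 : R)^'+] --> a + 0 * (K - a).
  apply: cvg_at_right_filter; apply: cvgD; first exact: cvg_cst.
  by apply: cvgMl; exact: cvg_id.
rewrite mul0r addr0 => lim_a; apply: (cvgr_to_ge lim_a); near=> t; apply: f_le.
  by near: t; exact: nbhs_right_gt.
by near: t; exact: nbhs_right_le.
Unshelve. all: by end_near. Qed.

End ConvexFunctions.

Section SecondOrderTaylor.
Variable R : realType.
Implicit Types (phi dphi ddphi : R -> R) (a b q r t B : R).

Lemma MVT_from0 phi dphi t :
  (forall r, `|r| <= `|t| -> is_derive r 1 phi (dphi r)) ->
  exists2 r, `|r| <= `|t| & phi t - phi 0 = dphi r * t.
Proof.
move=> phiP.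
have mvt a b : a <= b -> `|a| <= `|t| -> `|b| <= `|t| ->
    exists2 r, `|r| <= `|t| & phi b - phi a = dphi r * (b - a).
  move=> ab at_ bt.
  have between r : r \in `[a, b] -> `|r| <= `|t|.
    rewrite in_itv/= => /andP[ar rb]; move: at_ bt.
    rewrite !ler_norml => /andP[ta _] /andP[_ bt].
    by rewrite (le_trans ta) ?(le_trans rb).
  have [r rab||r rab phiE] := @MVT_segment R phi dphi a b ab.
  - by apply/phiP/between; exact: subset_itv_oo_cc.
  - apply: derivable_within_continuous => r /between rt.
    by have [] := phiP r rt.
  - by exists r => //; exact: between.
have [t0|t0] := leP 0 t.
  by have [|||r rt] := mvt 0 t; rewrite ?normr0 ?subr0//; exists r.
have [|||r rt phiE] := mvt t 0; rewrite ?normr0 ?(ltW t0)//; exists r => //.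
by rewrite -opprB phiE sub0r mulrN opprK.
Qed.

Lemma second_order_le phi dphi ddphi t B :
  (forall r, `|r| <= `|t| -> is_derive r 1 phi (dphi r)) ->
  (forall r, `|r| <= `|t| -> is_derive r 1 dphi (ddphi r)) ->
  (forall r, `|r| <= `|t| -> `|ddphi r| <= B) ->
  phi t <= phi 0 + t * dphi 0 + B * t ^+ 2.
Proof.
move=> phiP dphiP ddphi_le.
have [r rt phiE] := MVT_from0 phiP.
have [q qr dphiE] := MVT_from0 (fun q qr => dphiP q (le_trans qr rt)).
have : (dphi r - dphi 0) * t <= B * t ^+ 2.
  rewrite dphiE -mulrA (le_trans (ler_norm _))// normrM.
  have rt_le : `|r * t| <= t ^+ 2.
    by rewrite normrM -[t ^+ 2]real_normK ?num_real// expr2 ler_wpM2r.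
  by apply: ler_pM => //; exact/ddphi_le/(le_trans qr).
by move: phiE; lra.
Qed.

End SecondOrderTaylor.

Section DirectionalDerivatives.
Variables (R : realType) (V : normedModType R).
Implicit Types (f g : V -> R) (u v : V) (W : set V) (t : R).

Lemma is_derive_line f u v t : derivable f (t *: v + u) v ->
  is_derive t 1 (fun r => f (r *: v + u)) ('D_v f (t *: v + u)).
Proof.
pose phi r := f (r *: v + u).
have slopeE : (fun h : R => h^-1 *: ((phi \o shift t) (h *: 1) - phi t)) =
    (fun h : R => h^-1 *: ((f \o shift (t *: v + u)) (h *: v) - phi t)).
  by apply/funext => h; rewrite /phi/= [h *: 1]mulr1 scalerDl addrA.
by move=> df; split; rewrite /derivable /derive slopeE.
Qed.

Lemma near_eq_open f g W u : open W -> {in W, f =1 g} -> W u ->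
  \forall z \near u, f z = g z.
Proof.
move=> oW fg Wu; have nW : \forall z \near u, W z by apply: open_nbhs_nbhs.
by apply: filterS nW => z Wz; apply: fg; rewrite inE.
Qed.

Lemma derive_eq_open f g W v : open W -> {in W, f =1 g} ->
  {in W, 'D_v f =1 'D_v g}.
Proof.
by move=> oW fg u /[!inE] Wu; exact/near_eq_derive/(near_eq_open oW fg).
Qed.

Lemma derivable_eq_open f g W u v : open W -> {in W, f =1 g} -> W u ->
  derivable f u v -> derivable g u v.
Proof.
by move=> oW fg Wu; apply: near_eq_derivable; exact: near_eq_open oW fg Wu.
Qed.

Lemma within_continuous_at f W u : open W -> {within W, continuous f} -> W u ->
  {for u, continuous f}.
Proof.
by move=> oW + Wu; rewrite continuous_open_subspace//; apply; rewrite inE.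
Qed.

Lemma continuous_near_norm_le (I : finType) (h : I -> V -> R) u :
  (forall i, {for u, continuous (h i)}) ->
  exists B, \forall z \near u, forall i, `|h i z| <= B.
Proof.
move=> hc; exists (\sum_i `|h i u| + 1).
apply: (@filter_forall _ _ (fun i z => `|h i z| <= _) (nbhs u)) => i.
apply: (cvgr_norm_le (h i u) (hc i)).
by rewrite (bigD1 i)//= -addrA ltrDl ltr_wpDl// sumr_ge0.
Qed.

Lemma within_continuous_eq_sub f g U W : W `<=` U -> {in W, f =1 g} ->
  {within U, continuous f} -> {within W, continuous g}.
Proof.
move=> WU fg fU; apply: (subspace_eq_continuous (f := f)) => //.
exact: continuous_subspaceW fU.
Qed.

End DirectionalDerivatives.

Section QuadraticMajorant.
Variables (R : realType) (n : nat).
Implicit Types (U W C : set 'cV[R]_n) (f h : 'cV[R]_n -> R).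
Implicit Types (c d g p u x : 'cV[R]_n) (r t B K L : R).

Lemma C2_on_eq_open U W f h : open W -> W `<=` U -> {in W, f =1 h} ->
  C2_on U f -> C2_on W h.
Proof.
move=> oW WU fh [cf [df [cDf [dDf cDDf]]]].
have Dfh i : {in W, 'D_(evec R i) f =1 'D_(evec R i) h}.
  exact: derive_eq_open.
have DDfh i j : {in W, (fun z => 'D_(evec R j) ('D_(evec R i) f) z) =1
    (fun z => 'D_(evec R j) ('D_(evec R i) h) z)} by exact: derive_eq_open.
split; first exact: within_continuous_eq_sub WU fh cf.
split=> [i u Wu|]; first exact: derivable_eq_open oW fh Wu (df i u (WU u Wu)).
split=> [i|]; first exact: within_continuous_eq_sub WU (Dfh i) (cDf i).
split=> [i j u Wu|i j].
  exact: derivable_eq_open oW (Dfh i) Wu (dDf i j u (WU u Wu)).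
exact: within_continuous_eq_sub WU (DDfh i j) (cDDf i j).
Qed.

Definition partials f u : 'cV[R]_n := \col_i 'D_(evec R i) f u.

Lemma partials_grad f u : differentiable f u -> partials f u = grad f u.
Proof. by move=> fu; apply/colP => i; rewrite !mxE deriveE. Qed.

(* [`|d|] is the maximum norm, [dotv d d] the squared Euclidean norm. *)
Definition quad_majorized U f r K u p : Prop :=
  forall d, `|d| <= r ->
    U (u + d) /\ f (u + d) <= f u + dotv p d + K * dotv d d.

Lemma quad_majorizedW U f r K L u p : K <= L ->
  quad_majorized U f r K u p -> quad_majorized U f r L u p.
Proof.
move=> KL fq d /fq[Uud fud]; split=> //; apply: (le_trans fud).
by rewrite lerD2l ler_wpM2r ?dotv_ge0.
Qed.

Lemma axis_quad_majorized U f u r B : convex_set_R U -> convex_on U f -> U u ->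
  (forall (i : 'I_n) t, `|t| <= n.+1%:R * r -> let z := t *: evec R i + u in
    [/\ U z, derivable f z (evec R i),
        derivable ('D_(evec R i) f) z (evec R i) &
        `|'D_(evec R i) ('D_(evec R i) f) z| <= B]) ->
  quad_majorized U f r (n.+1%:R * B) u (partials f u).
Proof.
move=> Ucvx fcvx Uu axisP d d_le; have N0 : 0 < n.+1%:R :> R by rewrite ltr0n.
have step_le i : `|n.+1%:R * d i 0| <= n.+1%:R * r.
  rewrite normrM ger0_norm// ler_pM2l//.
  exact: le_trans (mx_norm_ge_coord _ _ _) d_le.
have axis_le i : f (u + (n.+1%:R * d i 0) *: evec R i) - f u <=
    n.+1%:R * d i 0 * partials f u i 0 + B * (n.+1%:R * d i 0) ^+ 2.
  rewrite [u + _]addrC lerBlDl addrA mxE.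
  have := @second_order_le R (fun t => f (t *: evec R i + u))
    (fun t => 'D_(evec R i) f (t *: evec R i + u))
    (fun t => 'D_(evec R i) ('D_(evec R i) f) (t *: evec R i + u))
    (n.+1%:R * d i 0) B.
  rewrite !scale0r !add0r.
  apply=> t t_le; have [_ df dDf DDf_le] :=
    axisP i t (le_trans t_le (step_le i)).
  - exact: is_derive_line.
  - exact: is_derive_line.
  - exact: DDf_le.
have U_axis i : U (u + (n.+1%:R * d i 0) *: evec R i).
  by rewrite addrC; have [] := axisP i _ (step_le i).
have [Uud fud] := convex_axis_le Ucvx fcvx Uu U_axis.
split=> //; apply: (le_trans fud); rewrite -addrA lerD2l ler_pdivrMl//.
apply: (le_trans (ler_sum _ (fun i _ => axis_le i))).
rewrite big_split/= mulrDr /dotv !mulr_sumr le_eqVlt.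
by apply/orP; left; apply/eqP; congr (_ + _); apply: eq_bigr => i _; ring.
Qed.

Lemma C2_quad_majorized_near U W f c : open W -> W `<=` U -> convex_set_R U ->
  convex_on U f -> C2_on W f -> W c ->
  \forall u \near c & M \near +oo, quad_majorized U f M^-1 M u (partials f u).
Proof.
move=> oW WU Ucvx fcvx [_ [df [_ [ddf cddf]]]] Wc.
pose DD i := 'D_(evec R i) ('D_(evec R i) f).
have [B DD_le] : exists B, \forall z \near c, forall i, `|DD i z| <= B.
  apply: continuous_near_norm_le => i.
  exact: within_continuous_at oW (cddf i i) Wc.
have nW : \forall z \near c, W z by apply: open_nbhs_nbhs.
have : \forall z \near c, W z /\ forall i, `|DD i z| <= B.
  by near=> z; split; near: z.
move=> /nbhs_normP[r /= r_gt0 rP].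
have near_c : \forall u \near c, `|u - c| < r / 2.
  by apply: near_dist_lt; rewrite divr_gt0.
near=> u M.
have M_ge : n.+1%:R * B <= M by near: M; apply: nbhs_pinfty_ge; exact: num_real.
have M_gt0 : 0 < M by near: M; apply: nbhs_pinfty_gt; exact: num_real.
have M_radius : n.+1%:R / (r / 2) <= M.
  by near: M; apply: nbhs_pinfty_ge; exact: num_real.
have step_le : n.+1%:R * M^-1 <= r / 2.
  by rewrite ler_pdivrMr// mulrC -ler_pdivrMr ?divr_gt0.
have uc : `|u - c| < r / 2 by near: u.
have [Wu _] : W u /\ forall i, `|DD i u| <= B.
  by apply: rP; rewrite /= distrC (lt_trans uc)// gtr_pMr// invf_lt1// ltr1n.
apply: (quad_majorizedW M_ge); apply: axis_quad_majorized => // [|i t t_le z].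
  exact: WU.
have [Wz DDz_le] : W z /\ forall i, `|DD i z| <= B.
  apply: rP; rewrite /= -opprB normrN /z -addrA (le_lt_trans (ler_normD _ _))//.
  rewrite [ltRHS]splitr ler_ltD// (le_trans (norm_scale_evec_le _ _))//.
  exact: le_trans t_le step_le.
by split; [exact: WU|exact: df|exact: ddf|exact: DDz_le].
Unshelve. all: by end_near. Qed.

Lemma partials_near_le W f c : open W -> C2_on W f -> W c ->
  \forall u \near c & M \near +oo, `|partials f u| <= M.
Proof.
move=> oW [_ [_ [cdf _]]] Wc.
have [B D_le] : exists B,
    \forall z \near c, forall i, `|'D_(evec R i) f z| <= B.
  apply: continuous_near_norm_le => i.
  exact: within_continuous_at oW (cdf i) Wc.
near=> u M.
have Du_le : forall i, `|'D_(evec R i) f u| <= B by near: u.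
have M_ge : B <= M by near: M; apply: nbhs_pinfty_ge; exact: num_real.
have M_ge0 : 0 <= M by near: M; apply: nbhs_pinfty_ge; exact: num_real.
by apply: mx_norm_le => // i j; rewrite mxE (le_trans (Du_le i)).
Unshelve. all: by end_near. Qed.

Lemma quad_majorized_cocoercive U f r K x x' g g' : 0 < K -> U x ->
  subgradient U f x g -> subgradient U f x' g' ->
  quad_majorized U f r K x' g' ->
  `|g' - g| <= 2 * K * r ->
  dotv (g' - g) (g' - g) <= 4 * K * dotv (x' - x) (g' - g).
Proof.
move=> K_gt0 Ux gP g'P fq y_le; pose d := - ((2 * K)^-1 *: (g' - g)).
have d_le : `|d| <= r.
  rewrite normrN normrZ gtr0_norm ?invr_gt0 ?mulr_gt0//.
  by rewrite ler_pdivrMl ?mulr_gt0.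
have [Uz upper] := fq d d_le; have lower := gP _ Uz; have tangent := g'P _ Ux.
have secantE :
    dotv (x' - x) (g' - g) = - dotv g' (x - x') - dotv g (x' - x).
  by rewrite -dotvNr opprB -dotvBl dotvC.
have stepE : dotv g' d - dotv g d = - ((2 * K)^-1 * dotv (g' - g) (g' - g)).
  by rewrite -dotvBl dotvNr dotvZr.
have curvatureE : K * dotv d d = (4 * K)^-1 * dotv (g' - g) (g' - g).
  by rewrite dotvNl dotvNr opprK dotvZl dotvZr; field; rewrite gt_eqF.
have halfE : (2 * K)^-1 = 2 * (4 * K)^-1 by field; rewrite gt_eqF.
rewrite addrAC dotvDr in lower; rewrite halfE -mulrA in stepE.
rewrite curvatureE in upper.
rewrite -ler_pdivrMl ?mulr_gt0// secantE.
move: upper lower tangent stepE; move: ((4 * K)^-1 * _) => w.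
move: (dotv g' d) (dotv g d) (dotv g' (x - x')) (dotv g (x' - x)).
by move=> g'd gd g'x gx; lra.
Qed.

Lemma C2_convex_grad_cocoercive U W f C : open W -> W `<=` U ->
  convex_set_R U -> convex_on U f -> C2_on W f -> compact C -> C `<=` W ->
  exists L, forall x x', C x -> C x' ->
    differentiable f x -> differentiable f x' ->
    let y := grad f x' - grad f x in dotv y y <= L * dotv (x' - x) y.
Proof.
move=> oW WU Ucvx fcvx fC2 /compact_near_coveringP cC CW.
have quad_near : \forall M \near +oo,
    C `<=` (fun u => quad_majorized U f M^-1 M u (partials f u)).
  by apply: cC => c /CW; exact: C2_quad_majorized_near.
have grad_near : \forall M \near +oo, C `<=` (fun u => `|partials f u| <= M).
  by apply: cC => c /CW; exact: partials_near_le.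
have [M [M_ge1 quadC gradC]] : exists M, [/\ 1 <= M,
    C `<=` (fun u => quad_majorized U f M^-1 M u (partials f u)) &
    C `<=` (fun u => `|partials f u| <= M)].
  near (+oo : set_system R) => M; exists M; split; near: M => //.
  by apply: nbhs_pinfty_ge; exact: num_real.
exists (4 * M ^+ 2) => x x' Cx Cx' fx fx' /=.
have UC u : C u -> U u by move=> /CW/WU.
have M_gt0 : 0 < M by rewrite (lt_le_trans ltr01).
have M_le_sqr : M <= M ^+ 2 by rewrite expr2 ler_peMr// ltW.
apply: (@quad_majorized_cocoercive U f M^-1) => //.
- by rewrite exprn_gt0.
- exact: UC.
- exact/convex_subgradient_grad/fx/UC.
- exact/convex_subgradient_grad/fx'/UC.
- by rewrite -partials_grad//; apply: (quad_majorizedW M_le_sqr); exact: quadC.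
rewrite expr2 mulrA mulfK ?gt_eqF// mulrDl !mul1r (le_trans (ler_normB _ _))//.
by rewrite -!partials_grad// lerD ?gradC.
Unshelve. all: by end_near. Qed.

End QuadraticMajorant.

Lemma compact_closure_col (R : realType) (n : nat) (A : set 'cV[R]_n) (M : R) :
  (forall z, A z -> `|z| <= M) -> compact (closure A).
Proof.
move=> AM.
have norm_le : closure A `<=` closed_ball_ Num.Def.normr 0 M.
  rewrite closureE; apply: smallest_sub; first exact: closed_closed_ball_.
  by move=> z Az; rewrite /closed_ball_/= sub0r normrN AM.
have -> : closure A = trmx @` (trmx @^-1` closure A : set 'rV[R]_n).
  apply/seteqP; split=> [z Az|_ [z Az <-]//].
  by exists z^T; rewrite /= ?trmxK.
apply: continuous_compact; first exact/continuous_subspaceT/trmx_continuous.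
apply: bounded_closed_compact.
  exists M; split=> [|N MN v /norm_le]; first exact: num_real.
  rewrite /closed_ball_/= sub0r normrN mx_norm_tr => /le_trans; apply.
  exact: ltW.
apply: preimage_closed; last exact: closed_closure.
by move=> v _; exact: trmx_continuous.
Qed.

Lemma ebounded_compact_closure (R : realType) (n : nat) (A : set 'cV[R]_n) :
  ebounded A -> compact (closure A).
Proof.
move=> [M AM]; apply: (@compact_closure_col _ _ _ M) => z Az.
exact: le_trans (norm_le_enorm _) (AM _ Az).
Qed.

Lemma compact_dist_compl_gt (R : realType) (n : nat) (C V : set 'cV[R]_n) :
  compact C -> open V -> C `<=` V ->
  exists2 delta : R, 0 < delta &
    C `<=` [set z | (delta%:E < dist_compl V z)%E]°.
Proof.
move=> /compact_near_coveringP cC oV CV.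
have dist_near : \forall delta \near (0 : R)^'+,
    C `<=` [set z | (delta%:E < dist_compl V z)%E]°.
  apply: cC => c Cc.
  have /nbhs_normP[r /= r_gt0 rV] : nbhs c V.
    by apply: open_nbhs_nbhs; split=> //; exact: CV.
  have near_c : \forall u \near c, \forall z \near u, `|z - c| < r / 2.
    by apply: near_join; apply: near_dist_lt; rewrite divr_gt0.
  near=> u delta.
  have delta_lt : delta < r / 2.
    by near: delta; apply: nbhs_right_lt; rewrite divr_gt0.
  apply: filterS (near near_c u _) => // z zc.
  apply: (@lt_le_trans _ _ (r / 2)%:E); first by rewrite lte_fin.
  apply/ereal_infP => _ [w Vw <-]; rewrite lee_fin leNgt; apply/negP => wz.
  apply: Vw; apply: rV; rewrite /= distrC -(subrK z w) -addrA.
  rewrite (le_lt_trans (ler_normD _ _))// [ltRHS]splitr ltrD//.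
  exact: le_lt_trans (norm_le_enorm _) wz.
have [delta [delta_gt0 CP]] : exists delta : R, 0 < delta /\
    C `<=` [set z | (delta%:E < dist_compl V z)%E]°.
  near (0 : R)^'+ => delta; exists delta; split; near: delta => //.
  exact: nbhs_right_gt.
by exists delta.
Unshelve. all: by end_near. Qed.

Lemma compact_C2_neighborhood (R : realType) (n : nat) (U V C A : set 'cV[R]_n)
    (f : 'cV[R]_n -> R) :
  compact C -> open V -> C `<=` V -> C `<=` A ->
  (forall delta : R, 0 < delta ->
     exists (Ud : set 'cV[R]_n) (fd : 'cV[R]_n -> R),
       [/\ open Ud, Ud `<=` U, A `<=` Ud, C2_on Ud fd &
           forall z, Ud z -> (delta%:E < dist_compl V z)%E -> fd z = f z]) ->
  exists W, [/\ open W, W `<=` U, C `<=` W & C2_on W f].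
Proof.
move=> cC oV CV CA smooth.
have [delta delta_gt0 Cdelta] := compact_dist_compl_gt cC oV CV.
have [Ud [fd [oUd UdU AUd fdC2 fdE]]] := smooth delta delta_gt0.
exists (Ud `&` [set z | (delta%:E < dist_compl V z)%E]°); split.
- exact: openI oUd (open_interior _).
- by move=> z [/UdU].
- by move=> z Cz; split; [exact/AUd/CA|exact: Cdelta].
apply: C2_on_eq_open fdC2; first exact: openI oUd (open_interior _).
  by move=> z [].
by move=> z /[!inE] -[Udz /interior_subset]; exact: fdE.
Qed.

Lemma convex_liminf_grad_inf (R : realType) (n : nat) (U : set 'cV[R]_n)
    (f : 'cV[R]_n -> R) (x : nat -> 'cV[R]_n) (M : R) : convex_on U f ->
  (forall k, [/\ U (x k), differentiable f (x k) & enorm (x k) <= M]) ->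
  (forall e, 0 < e -> exists k, enorm (grad f (x k)) < e) ->
  ereal_inf (range (fun k => (f (x k))%:E)) = inf_on f U.
Proof.
move=> fcvx xP liminf; apply/eqP; rewrite eq_le; apply/andP; split; last first.
  by apply: ereal_inf_le_tmp => _ [k _ <-]; exists (x k) => //; have [] := xP k.
apply/ereal_infP => _ [z Uz <-]; apply/lee_addgt0Pr => e e_gt0.
have L_gt0 : 0 < M + enorm z + 1.
  have [_ _ xM] := xP 0%N; rewrite ltr_wpDl// addr_ge0 ?enorm_ge0//.
  exact: le_trans (enorm_ge0 _) xM.
have [k gk_lt] := liminf _ (divr_gt0 e_gt0 L_gt0); have [Ux fx xM] := xP k.
apply: (@le_trans _ _ (f (x k))%:E); first by apply: ereal_inf_lbound; exists k.
rewrite -EFinD lee_fin.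
have gP := convex_subgradient_grad fcvx Ux fx.
apply: (le_trans (subgradient_le_enorm gP Uz)); rewrite lerD2l.
apply: (@le_trans _ _ (e / (M + enorm z + 1) * (M + enorm z + 1))).
  apply: ler_pM; rewrite ?enorm_ge0 ?addr_ge0 ?enorm_ge0 ?(ltW gk_lt)//.
  by rewrite -addrA lerD// lerDl.
by rewrite divfK// gt_eqF.
Qed.

Lemma bfgs_sequence_cvg_inf (R : realType) (n : nat) (U W : set 'cV[R]_n)
    (f : 'cV[R]_n -> R) (x : nat -> 'cV[R]_n) :
  convex_set_R U -> convex_on U f -> bfgs_sequence f x -> ebounded (range x) ->
  open W -> W `<=` U -> C2_on W f -> closure (range x) `<=` W ->
  (fun k => (f (x k))%:E) @ \oo --> inf_on f U.
Proof.
move=> Ucvx fcvx x_bfgs x_bounded oW WU fC2 CW.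
have fx k : differentiable f (x k) by case: x_bfgs => /(_ k)[].
have Cx k : closure (range x) (x k) by apply: subset_closure; exists k.
have Ux k : U (x k) by exact/WU/CW.
have [L cocoercive] := C2_convex_grad_cocoercive oW WU Ucvx fcvx fC2
  (ebounded_compact_closure x_bounded) CW.
have [M xM] := x_bounded.
have {}xM k : enorm (x k) <= M by apply: xM; exists k.
have f_ge k :
    f (x 0%N) - enorm (grad f (x 0%N)) * (enorm (x 0%N) + M) <= f (x k).
  have g0 := convex_subgradient_grad fcvx (Ux 0%N) (fx 0%N).
  rewrite lerBlDr (le_trans (subgradient_le_enorm g0 (Ux k)))//.
  by rewrite lerD2l ler_wpM2l ?enorm_ge0// lerD2l.
have liminf := bfgs_sequence_liminf_grad x_bfgs
  (fun k => cocoercive _ _ (Cx k) (Cx k.+1) (fx k) (fx k.+1)) f_ge.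
have xP k : [/\ U (x k), differentiable f (x k) & enorm (x k) <= M] by [].
rewrite -(convex_liminf_grad_inf fcvx xP liminf).
apply: ereal_nonincreasing_cvgn => i j ij; rewrite lee_fin.
exact: (bfgs_sequence_nonincreasing x_bfgs).
Qed.

Theorem theorem4p3 (R : realType) (n : nat) (U : set 'cV[R]_n)
  (f : 'cV[R]_n -> R) (x : nat -> 'cV[R]_n) (V : set 'cV[R]_n) :
  open U -> convex_set_R U -> convex_on U f ->
  bfgs_sequence f x -> (forall k, U (x k)) ->
  ebounded [set z | U z /\ f z <= f (x 0%N)] ->
  open V -> V `<=` U -> closure (range x) `<=` V ->
  inf_on f V = inf_on f U ->
  (forall delta : R, 0 < delta ->
     exists (Ud : set 'cV[R]_n) (fd : 'cV[R]_n -> R),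
       [/\ open Ud, convex_set_R Ud, Ud `<=` U &
           [set z | U z /\ f z <= f (x 0%N)] `<=` Ud] /\
       [/\ C2_on Ud fd, convex_on Ud fd &
           forall z, Ud z -> (delta%:E < dist_compl V z)%E -> fd z = f z]) ->
  (fun k => (f (x k))%:E) @ \oo --> inf_on f U.
Proof.
move=> oU Ucvx fcvx x_bfgs Ux [M level_le] oV VU CV _ smooth.
pose level : set 'cV[R]_n := [set z | U z /\ f z <= f (x 0%N)].
have x_level : range x `<=` level.
  move=> _ [k _ <-]; split=> //.
  exact: bfgs_sequence_nonincreasing x_bfgs _ _ _.
have x_bounded : ebounded (range x) by exists M => z /x_level/level_le.
have closure_level : closure (range x) `<=` level.
  move=> c Cc; have Uc : U c by exact/VU/CV.
  split=> //; apply: (convex_sublevel_closure oU Ucvx fcvx Uc).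
  exact: closureS x_level _ Cc.
have [W [oW WU CW fC2]] : exists W,
    [/\ open W, W `<=` U, closure (range x) `<=` W & C2_on W f].
  have compactC := ebounded_compact_closure x_bounded.
  apply: (compact_C2_neighborhood compactC oV CV closure_level).
  move=> delta /smooth.
  by move=> [Ud [fd [[oUd _ UdU levelUd] [fdC2 _ fdE]]]]; exists Ud, fd.
exact: (bfgs_sequence_cvg_inf Ucvx fcvx x_bfgs x_bounded oW WU fC2 CW).
Qed.
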